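(* Let $G$ and $H$ be simple graphs. Then $$\chi(G)\leq\left(\chi(H)\right)^{\mathrm{C}(G;H)}.$$ Equivalently (whenever the logarithm is defined), $\log_{\chi(H)}\chi(G)\leq \mathrm{C}(G;H)$.
   Context: A simple graph is an undirected graph without loops and without multiple edges. A homomorphism $f:G\to H$ is a map $f:V(G)\to V(H)$ with $f(u)f(v)\in E(H)$ whenever $uv\in E(G)$. A subgraph of $G$ is a graph whose vertex and edge sets are subsets of $V(G)$, $E(G)$. The union $G_1\cup\cdots\cup G_k$ has vertex set $\bigcup_i V(G_i)$ and edge set $\bigcup_i E(G_i)$. The chromatic number $\chi(G)$ is the smallest number of colours in an assignment of colours to the vertices of $G$ such that adjacent vertices have different colours; $\chi(G)$ and $\chi(H)$ are finite. The hom-complexity $\mathrm{C}(G;H)$ is the least positive integer $k$ such that there are subgraphs $G_1,\dots,G_k$ of $G$ with $G=G_1\cup\cdots\cup G_k$ and, for each $i$, a homomorphism $G_i\to H$; $\mathrm{C}(G;H)=\infty$ if no such $k$ exists. If $\mathrm{C}(G;H)=\infty$, both inequalities are regarded as holding by convention. *)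

(* Defs.v *)
From mathcomp Require Import all_boot all_order all_algebra.
From mathcomp Require Import boolp classical_sets reals.

Set Implicit Arguments.
Unset Strict Implicit.
Unset Printing Implicit Defensive.

Local Open Scope classical_set_scope.

(* The vertex type may be empty or infinite. *)
Record sgraph := SGraph {
  vertex :> Type;
  adj : vertex -> vertex -> Prop;
  adj_sym : forall u v, adj u v -> adj v u;
  adj_irrefl : forall v, ~ adj v v
}.

Definition is_hom (G H : sgraph) (f : G -> H) : Prop :=
  forall u v : G, adj u v -> adj (f u) (f v).

(* Subgraphs need not be spanning, nor induced. *)
Record subgraph (G : sgraph) := Subgraph {
  sub_vertices : set G;
  sub_adj : G -> G -> Prop;
  sub_adj_sym : forall u v, sub_adj u v -> sub_adj v u;
  sub_adj_edge : forall u v, sub_adj u v -> adj u v;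
  sub_adj_vertex : forall u v, sub_adj u v -> sub_vertices u
}.

Section SubgraphAsGraph.
Variables (G : sgraph) (S : subgraph G).

Let V := {v : G | sub_vertices S v}.
Let E (u v : V) : Prop := sub_adj S (sval u) (sval v).

Fact sgraph_of_subgraph_sym (u v : V) : E u v -> E v u.
Proof. exact: sub_adj_sym. Qed.

Fact sgraph_of_subgraph_irrefl (v : V) : ~ E v v.
Proof. by move=> /sub_adj_edge /adj_irrefl. Qed.

Definition sgraph_of_subgraph : sgraph :=
  SGraph sgraph_of_subgraph_sym sgraph_of_subgraph_irrefl.

End SubgraphAsGraph.

Coercion sgraph_of_subgraph : subgraph >-> sgraph.

Definition is_union (G : sgraph) (k : nat) (S : 'I_k -> subgraph G) : Prop :=
  \bigcup_i sub_vertices (S i) = setT /\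
  forall u v : G, adj u v <-> exists i, sub_adj (S i) u v.

(* [Some n] if [n] is the least element of [P]; [None], read as infinity, if
   [P] is empty. *)
Definition least (P : set nat) : option nat :=
  if pselect (exists n, n \in P) is left exP then Some (ex_minn exP) else None.

Definition colorable (G : sgraph) (n : nat) : Prop :=
  exists c : G -> 'I_n, forall u v : G, adj u v -> c u <> c v.

Definition chromatic_number (G : sgraph) : option nat :=
  least [set n | colorable G n].

Definition hom_complexity (G H : sgraph) : option nat :=
  least [set k | (0 < k)%N /\
    exists S : 'I_k -> subgraph G,
      is_union S /\ forall i, exists f : S i -> H, is_hom f].

(* Main.v *)
Require Import Defs.
From mathcomp Require Import all_boot all_order all_algebra.
From mathcomp Require Import boolp classical_sets reals exp.

Set Implicit Arguments.
Unset Strict Implicit.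
Unset Printing Implicit Defensive.

Local Open Scope ring_scope.

(* Colour each vertex v of G by the k-tuple whose i-th entry is the H-colour of
   the image of v under the i-th homomorphism (arbitrary if v is not in G_i).
   An edge of G lies in some G_i, so its ends differ in the i-th entry. *)

Import Order.TTheory GRing.Theory Num.Theory.

Lemma leastP (P : set nat) (n : nat) : least P = Some n ->
  P n /\ forall k, P k -> (n <= k)%N.
Proof.
rewrite /least; case: pselect => // exP [<-].
case: ex_minnP => i /set_mem Pi mini; split=> // k Pk.
exact/mini/mem_set.
Qed.

(** Allows the colours to be finite functions from ['I_k] to ['I_m]. *)
Lemma colorable_card (G : sgraph) (T : finType) (c : G -> T) :
  (forall u v : G, adj u v -> c u <> c v) -> colorable G #|T|.
Proof.
move=> cP; exists (fun v => enum_rank (c v)) => u v uv /enum_rank_inj.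
exact: cP.
Qed.

Lemma sub_adj_vertices (G : sgraph) (S : subgraph G) (u v : G) :
  sub_adj S u v -> sub_vertices S u /\ sub_vertices S v.
Proof.
by move=> uv; split; [| move/sub_adj_sym: uv => uv]; apply: sub_adj_vertex uv.
Qed.

Lemma colorable_union (G H : sgraph) (k m : nat) (S : 'I_k -> subgraph G) :
  is_union S -> (forall i, exists f : S i -> H, is_hom f) ->
  colorable H m -> colorable G (m ^ k).
Proof.
move=> [SV SE] S_hom [c cP].
pose f i := sval (cid (S_hom i)).
have fP i : is_hom (f i) by exact: svalP.
(* The default colour is chosen per vertex since m may be 0. *)
have /choice[d _] (v : G) : exists _ : 'I_m, True.
  (* Even an isolated [v] lies in some [S i], so its image there supplies a colour. *)
  have [i _ vi] : (\bigcup_i sub_vertices (S i))%classic v by rewrite SV.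
  by exists (c (f i (exist _ v vi))).
pose col (v : G) := [ffun i => if pselect (sub_vertices (S i) v) is left vi
  then c (f i (exist _ v vi)) else d v].
suff /colorable_card: forall u v, adj u v -> col u <> col v.
  by rewrite card_ffun !card_ord.
move=> u v /SE[i uv] /ffunP/(_ i); rewrite !ffunE.
have [ui vi] := sub_adj_vertices uv.
(* Adjacency in [S i] depends only on the underlying vertices, so [uv] fits whichever membership
   proofs [pselect] returns. *)
do 2![case: pselect => // ?].
exact/cP/fP.
Qed.

(* Finite chromatic numbers n of G and m of H; when the hom-complexity is
   infinite ([None]) both inequalities hold by convention. The logarithm of n
   to base m is defined exactly when 1 < m and 0 < n. *)
Theorem theorem3p26 (R : realType) (G H : sgraph) (n m : nat)
    (chiG : chromatic_number G = Some n)
    (chiH : chromatic_number H = Some m) :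
  forall k : nat, hom_complexity G H = Some k ->
    (n <= m ^ k)%N /\
    ((1 < m)%N -> (0 < n)%N -> ln (n%:R : R) / ln (m%:R : R) <= k%:R).
Proof.
move=> k /leastP[[_ [S [SU Sf]]] _].
have [_ n_min] := leastP chiG; have [Hm _] := leastP chiH.
have le_n_mk : (n <= m ^ k)%N by exact/n_min/(colorable_union SU Sf Hm).
split=> // m_gt1 n_gt0.
have m_gt0 : (0 < m)%N by exact: ltnW.
(* As [ln m] is positive for [1 < m], clearing it leaves [ln n <= ln (m ^ k)]. *)
rewrite ler_pdivrMr ?ln_gt0 ?ltr1n// mulr_natl -lnXn ?ltr0n//.
by rewrite ler_ln ?posrE ?exprn_gt0 ?ltr0n// -natrX ler_nat.
Qed.
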